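(* Let $\mathrm{TL}(B_n)$ ($n\ge1$) be the type $B$ Temperley--Lieb algebra over $\mathbb{C}(q)$ with loop parameter $\delta=q+q^{-1}$. Define elements $b_{n,\pm}\in\mathrm{TL}(B_n)$ recursively by $b_{1,\pm}=\frac12(1\pm s_0)$ and $$b_{n+1,\pm}=b_{n,\pm}-\frac{q^{n-1}+q^{-(n-1)}}{q^n+q^{-n}}\;b_{n,\pm}U_nb_{n,\pm}.$$ Then for every $n\ge1$: (i) $b_{n,+}$ is the unique non-zero idempotent in $\mathrm{TL}(B_n)$ satisfying $s_0b_{n,+}=b_{n,+}=b_{n,+}s_0$ and $U_ib_{n,+}=0=b_{n,+}U_i$ for all $i=1,\dots,n-1$. (ii) $b_{n,-}$ is the unique non-zero idempotent in $\mathrm{TL}(B_n)$ satisfying $s_0b_{n,-}=-b_{n,-}=b_{n,-}s_0$ and $U_ib_{n,-}=0=b_{n,-}U_i$ for all $i=1,\dots,n-1$.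
   Context: $\mathrm{TL}(B_n)$ is the unital associative algebra with generators $s_0,U_1,\dots,U_{n-1}$ and relations: $U_i^2=\delta U_i$; $U_iU_{i+1}U_i=U_i$ and $U_{i+1}U_iU_{i+1}=U_{i+1}$ for $1\le i\le n-2$; $U_iU_j=U_jU_i$ for $|i-j|\ge2$; $s_0^2=1$; $U_1s_0U_1=0$; $s_0U_i=U_is_0$ for $i\ge2$. $\mathrm{TL}(B_n)$ is regarded as a subalgebra of $\mathrm{TL}(B_{n+1})$ by sending generators to generators of the same name. It is known that $\mathrm{TL}(B_n)$ has a basis of dotted Temperley--Lieb diagrams: crossingless matchings of $n+n$ points on two parallel horizontal lines, each strand carrying at most one dot, each dotted strand being reachable from the left side of the diagram without crossing strands; multiplication is stacking, two dots on a strand cancel, an undotted circle equals $\delta$, a dotted circle equals $0$; $U_i$ is the cup-cap diagram at positions $i,i+1$ and $s_0$ the identity diagram with a dot on the first strand. *)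

(* Defs.v *)
From HB Require Import structures.
From mathcomp Require Import all_boot all_order all_algebra.
From mathcomp Require Import boolp reals.
From mathcomp Require Import complex finmap monalg.
Set Implicit Arguments.
Unset Strict Implicit.
Unset Printing Implicit Defensive.
Import GRing.Theory.
Import Quotient.
Local Open Scope ring_scope.
Local Open Scope quotient_scope.

Section FreeAlgebra.
Variables (K : fieldType) (I : choiceType).

Lemma malg_mulUU (a b : K) (m p : {fmonom I}) :
  << a *g m >> * << b *g p >> = << a * b *g mmul m p >> :> {malg K[{fmonom I}]}.
Proof. by rewrite malgM_def fgmulUU. Qed.

Lemma malg_mulC (c : K) (x : {malg K[{fmonom I}]}) : c%:MP * x = x * c%:MP.
Proof.
rewrite [x]monalgE mulr_sumr mulr_suml.
by apply: eq_bigr => l _; rewrite !malg_mulUU mul1m mulm1 mulrC.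
Qed.

Lemma central_scalerAr (A : lalgType K) (f : K -> A) :
  (forall c x, f c * x = c *: x) -> (forall c x, f c * x = x * f c) ->
  forall c (x y : A), c *: (x * y) = x * (c *: y).
Proof. by move=> fZ fC c x y; rewrite -!fZ mulrA fC mulrA. Qed.

(* The free unital associative K-algebra on I: the monoid algebra of the free
   monoid {fmonom I}. *)
Definition freealg_sort := {malg K[{fmonom I}]}.
HB.instance Definition _ := GRing.Lalgebra.on freealg_sort.
HB.instance Definition _ := GRing.Lalgebra_isAlgebra.Build K freealg_sort
  (central_scalerAr (@mul_malgC _ K) malg_mulC).
Definition freealg : algType K := freealg_sort.

Definition freegen (i : I) : freealg := << fmu i >>.

End FreeAlgebra.

Section FreeAlgebraEval.
Variables (K : fieldType) (I : choiceType) (S : algType K) (g : I -> S).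

Definition fmon_eval (m : {fmonom I}) : S := \prod_(i <- m) g i.

Lemma fmon_eval_mmorphism : mmorphism fmon_eval.
Proof.
split=> [m p|]; first by rewrite /fmon_eval fmM big_cat.
by rewrite /fmon_eval fm1 big_nil.
Qed.

HB.instance Definition _ :=
  isMultiplicative.Build {fmonom I} S fmon_eval fmon_eval_mmorphism.

(* The algebra morphism out of the free algebra with prescribed values g. *)
Definition freealg_eval (x : freealg K I) : S :=
  mmap (in_alg S) fmon_eval x.

Lemma freealg_eval_zmod : zmod_morphism freealg_eval.
Proof. exact: (@mmap_is_additive _ _ _ (in_alg S) fmon_eval). Qed.

Lemma freealg_eval_monoid : monoid_morphism freealg_eval.
Proof.
have [|M M1] := @commr_mmap_is_multiplicative _ _ _ (in_alg S) fmon_eval.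
  by move=> x m p; rewrite /GRing.comm /= mulr_algl mulr_algr.
by split.
Qed.

Lemma freealg_eval_scalable : scalable freealg_eval.
Proof. by move=> c x; rewrite /freealg_eval mmapZ /= mulr_algl. Qed.

HB.instance Definition _ :=
  GRing.isZmodMorphism.Build (freealg K I) S freealg_eval freealg_eval_zmod.
HB.instance Definition _ :=
  GRing.isMonoidMorphism.Build (freealg K I) S freealg_eval freealg_eval_monoid.
HB.instance Definition _ :=
  GRing.isScalable.Build K (freealg K I) S *:%R freealg_eval
    freealg_eval_scalable.

Lemma freealg_eval_gen i : freealg_eval (freegen K i) = g i.
Proof.
by rewrite /freealg_eval mmapU /= scale1r mul1r /fmon_eval fmU big_seq1.
Qed.

End FreeAlgebraEval.

(* Quotient of an algebra A by the relations x = y for all x, y with rel x y. *)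
Section AlgebraQuotient.
Variables (K : fieldType) (A : algType K) (rel : A -> A -> Prop).

(* The two-sided ideal generated by the x - y with rel x y. *)
Inductive rel_idealP : A -> Prop :=
| rel_ideal_rel x y : rel x y -> rel_idealP (x - y)
| rel_ideal0 : rel_idealP 0
| rel_idealD x y : rel_idealP x -> rel_idealP y -> rel_idealP (x + y)
| rel_idealMl a x : rel_idealP x -> rel_idealP (a * x)
| rel_idealMr a x : rel_idealP x -> rel_idealP (x * a).

Lemma rel_idealP_eval (S : nzRingType) (f : {rmorphism A -> S}) :
  (forall x y, rel x y -> f x = f y) -> forall x, rel_idealP x -> f x = 0.
Proof.
move=> fP x; elim=> {x} [x y /fP xy||x y _ x0 _ y0|a x _ x0|a x _ x0].
- by rewrite rmorphB xy subrr.
- by rewrite rmorph0.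
- by rewrite rmorphD x0 y0 addr0.
- by rewrite rmorphM x0 mulr0.
- by rewrite rmorphM x0 mul0r.
Qed.

Definition rel_ideal : {pred A} := fun x => `[< rel_idealP x >].

Lemma rel_ideal_zmod_closed : zmod_closed rel_ideal.
Proof.
split=> [|x y /asboolP Ix /asboolP Iy]; apply/asboolP; first exact: rel_ideal0.
by apply: rel_idealD => //; rewrite -mulN1r; apply: rel_idealMl.
Qed.

HB.instance Definition _ :=
  GRing.isZmodClosed.Build A rel_ideal rel_ideal_zmod_closed.

(* In MathComp algebras are nontrivial, whence the hypothesis. *)
Hypothesis proper : ~ rel_idealP 1.

Definition algquot_sort of ~ rel_idealP 1 := {quot rel_ideal}.
Local Notation Q := (algquot_sort proper).

HB.instance Definition _ := GRing.Zmodule.on Q.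
HB.instance Definition _ := EqQuotient.on Q.

Definition algpi_fun (x : A) : Q := \pi x.
Local Notation pi := algpi_fun.

Lemma algpi_funP x y : reflect (rel_idealP (x - y)) (pi x == pi y).
Proof. by rewrite -idealrBE; apply: asboolP. Qed.

Lemma repr_algpi_fun x : rel_idealP (repr (pi x) - x).
Proof. by apply/algpi_funP; rewrite /pi reprK. Qed.

Lemma algpi_fun0 : pi 0 = 0.
Proof. by rewrite /pi /algquot_sort !piE. Qed.

Lemma algpi_funB : {morph pi : x y / x - y}.
Proof. by move=> x y; rewrite /pi /algquot_sort !piE. Qed.

Lemma algpi_funD : {morph pi : x y / x + y}.
Proof. by move=> x y; rewrite /pi /algquot_sort !piE. Qed.

Definition algquot_one : Q := pi 1.
Definition algquot_mul (x y : Q) : Q := pi (repr x * repr y).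
Definition algquot_scale (c : K) (x : Q) : Q := pi (c *: repr x).

Lemma algpi_funM : {morph pi : x y / x * y >-> algquot_mul x y}.
Proof.
move=> x y; apply/esym/eqP/algpi_funP.
have -> : repr (pi x) * repr (pi y) - x * y
    = (repr (pi x) - x) * repr (pi y) + x * (repr (pi y) - y).
  by rewrite mulrBl mulrBr addrA subrK.
by apply: rel_idealD; [apply: rel_idealMr|apply: rel_idealMl];
  apply: repr_algpi_fun.
Qed.

Lemma algpi_funZ c : {morph pi : x / c *: x >-> algquot_scale c x}.
Proof.
move=> x; apply/esym/eqP/algpi_funP.
by rewrite -scalerBr -mulr_algl; apply/rel_idealMl/repr_algpi_fun.
Qed.

Lemma algquot_sort_ind (P : Q -> Prop) : (forall x, P (pi x)) -> forall x, P x.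
Proof. by move=> Ppi x; rewrite -[x]reprK; apply: Ppi. Qed.

Fact algquot_mulA : associative algquot_mul.
Proof.
elim/algquot_sort_ind=> x; elim/algquot_sort_ind=> y; elim/algquot_sort_ind=> z.
by rewrite -!algpi_funM mulrA.
Qed.

Fact algquot_mul1 : left_id algquot_one algquot_mul.
Proof. by elim/algquot_sort_ind=> x; rewrite -algpi_funM mul1r. Qed.

Fact algquot_mulr1 : right_id algquot_one algquot_mul.
Proof. by elim/algquot_sort_ind=> x; rewrite -algpi_funM mulr1. Qed.

Fact algquot_mulDl : left_distributive algquot_mul +%R.
Proof.
elim/algquot_sort_ind=> x; elim/algquot_sort_ind=> y; elim/algquot_sort_ind=> z.
by rewrite -algpi_funD -!algpi_funM mulrDl algpi_funD.
Qed.

Fact algquot_mulDr : right_distributive algquot_mul +%R.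
Proof.
elim/algquot_sort_ind=> x; elim/algquot_sort_ind=> y; elim/algquot_sort_ind=> z.
by rewrite -algpi_funD -!algpi_funM mulrDr algpi_funD.
Qed.

Fact algquot_one_neq0 : algquot_one != 0.
Proof.
by rewrite -algpi_fun0; apply/algpi_funP; rewrite subr0.
Qed.

HB.instance Definition _ := GRing.Zmodule_isNzRing.Build Q
  algquot_mulA algquot_mul1 algquot_mulr1 algquot_mulDl algquot_mulDr
  algquot_one_neq0.

Fact algquot_scaleA a b x :
  algquot_scale a (algquot_scale b x) = algquot_scale (a * b) x.
Proof. by elim/algquot_sort_ind: x => x; rewrite -!algpi_funZ scalerA. Qed.

Fact algquot_scale1 : left_id 1 algquot_scale.
Proof. by elim/algquot_sort_ind=> x; rewrite -algpi_funZ scale1r. Qed.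

Fact algquot_scaleDr : right_distributive algquot_scale +%R.
Proof.
move=> c; elim/algquot_sort_ind=> x; elim/algquot_sort_ind=> y.
by rewrite -algpi_funD -!algpi_funZ scalerDr algpi_funD.
Qed.

Fact algquot_scaleDl x : {morph algquot_scale^~ x : a b / a + b}.
Proof.
by elim/algquot_sort_ind: x => x a b /=; rewrite -!algpi_funZ scalerDl algpi_funD.
Qed.

HB.instance Definition _ := GRing.Zmodule_isLmodule.Build K Q
  algquot_scaleA algquot_scale1 algquot_scaleDr algquot_scaleDl.

Fact algquot_scaleAl (c : K) (x y : Q) : c *: (x * y) = (c *: x) * y.
Proof.
elim/algquot_sort_ind: x => x; elim/algquot_sort_ind: y => y.
rewrite -[_ * _]algpi_funM -[_ *: pi x]algpi_funZ.
by rewrite -[LHS]algpi_funZ -[RHS]algpi_funM scalerAl.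
Qed.

HB.instance Definition _ := GRing.Lmodule_isLalgebra.Build K Q algquot_scaleAl.

Fact algquot_scaleAr (c : K) (x y : Q) : c *: (x * y) = x * (c *: y).
Proof.
elim/algquot_sort_ind: x => x; elim/algquot_sort_ind: y => y.
rewrite -[_ * _]algpi_funM -[_ *: pi y]algpi_funZ.
by rewrite -[LHS]algpi_funZ -[RHS]algpi_funM scalerAr.
Qed.

HB.instance Definition _ := GRing.Lalgebra_isAlgebra.Build K Q algquot_scaleAr.

Definition algquot : algType K := Q.

Definition algpi (x : A) : algquot := pi x.

HB.instance Definition _ :=
  GRing.isZmodMorphism.Build A algquot algpi algpi_funB.
HB.instance Definition _ :=
  GRing.isMonoidMorphism.Build A algquot algpi (erefl, algpi_funM).
HB.instance Definition _ :=
  GRing.isScalable.Build K A algquot *:%R algpi algpi_funZ.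

Lemma algpiP x y : reflect (rel_idealP (x - y)) (algpi x == algpi y).
Proof. exact: algpi_funP. Qed.

Lemma algpi_rel x y : rel x y -> algpi x = algpi y.
Proof. by move=> xy; apply/eqP/algpiP/rel_ideal_rel. Qed.

Lemma algquot_ind (P : algquot -> Prop) :
  (forall x, P (algpi x)) -> forall x, P x.
Proof. exact: algquot_sort_ind. Qed.

(* The map induced by f on the quotient; see algquot_lift_pi. *)
Definition algquot_lift (S : algType K) (f : A -> S) (x : algquot) : S :=
  f (repr (x : Q)).

Lemma algquot_lift_pi (S : algType K) (f : {rmorphism A -> S}) :
  (forall x y, rel x y -> f x = f y) ->
  forall x, algquot_lift f (algpi x) = f x.
Proof.
move=> fP x; apply/eqP; rewrite -subr_eq0 -rmorphB.
by apply/eqP/(rel_idealP_eval fP)/repr_algpi_fun.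
Qed.

End AlgebraQuotient.

(* The defining relations x = y of TL(B_n), for elements s and u i of an algebra
   A; here s stands for s_0 and u i for U_(i+1), 0 <= i < n - 1. *)
Inductive TLB_rel (K : fieldType) (delta : K) (n : nat) (A : algType K)
    (s : A) (u : 'I_n.-1 -> A) : A -> A -> Prop :=
| TLB_rel_UU i : TLB_rel delta s u (u i * u i) (delta *: u i)
| TLB_rel_UUU (i j : 'I_n.-1) : j = i.+1 :> nat ->
    TLB_rel delta s u (u i * u j * u i) (u i)
| TLB_rel_UUUr (i j : 'I_n.-1) : j = i.+1 :> nat ->
    TLB_rel delta s u (u j * u i * u j) (u j)
| TLB_rel_comm (i j : 'I_n.-1) : (i.+2 <= j)%N || (j.+2 <= i)%N ->
    TLB_rel delta s u (u i * u j) (u j * u i)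
| TLB_rel_ss : TLB_rel delta s u (s * s) 1
| TLB_rel_UsU (i : 'I_n.-1) : i = 0%N :> nat ->
    TLB_rel delta s u (u i * s * u i) 0
| TLB_rel_sU (i : 'I_n.-1) : (1 <= i)%N -> TLB_rel delta s u (s * u i) (u i * s).

Lemma TLB_rel_image (K : fieldType) (delta : K) (n : nat) (A B : algType K)
    (f : {lrmorphism A -> B}) (s : A) (u : 'I_n.-1 -> A) (x y : A) :
  TLB_rel delta s u x y -> TLB_rel delta (f s) (f \o u) (f x) (f y).
Proof.
case=> [i|i j ij|i j ij|i j ij||i i0|i i1];
  rewrite ?linearZ ?rmorphM ?rmorph1 ?rmorph0.
- exact: (TLB_rel_UU _ _ (f \o u)).
- exact: (TLB_rel_UUU _ _ (f \o u)).
- exact: (TLB_rel_UUUr _ _ (f \o u)).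
- exact: (TLB_rel_comm _ _ (f \o u)).
- exact: TLB_rel_ss.
- exact: (TLB_rel_UsU _ _ (f \o u)).
- exact: (TLB_rel_sU _ _ (f \o u)).
Qed.

Lemma TLB_rel_morph (K : fieldType) (delta : K) (n : nat) (A B : algType K)
    (f : {lrmorphism A -> B}) (s : A) (u : 'I_n.-1 -> A) :
  (forall x y, TLB_rel delta s u x y -> f x = f y) ->
  forall x y, TLB_rel delta (f s) (f \o u) x y -> x = y.
Proof.
move=> fP _ _ [i|i j ij|i j ij|i j ij||i i0|i i1] /=;
  rewrite -?linearZ -?rmorphM -?(rmorph1 f) -?(rmorph0 f); apply: fP.
- exact: TLB_rel_UU.
- exact: TLB_rel_UUU.
- exact: TLB_rel_UUUr.
- exact: TLB_rel_comm.
- exact: TLB_rel_ss.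
- exact: TLB_rel_UsU.
- exact: TLB_rel_sU.
Qed.

Section TLB.
Variables (K : fieldType) (delta : K).

Section Presentation.
Variable n : nat.

(* Names of the generators of TL(B_n): None for s_0 and Some i for U_(i+1). *)
Definition TLB_index : choiceType := option 'I_n.-1.

Definition TLB_free_rel : freealg K TLB_index -> freealg K TLB_index -> Prop :=
  TLB_rel delta (freegen K (None : TLB_index))
    (fun i => freegen K (Some i : TLB_index)).

Lemma TLB_free_rel_eval (S : algType K) (g : TLB_index -> S) :
  (forall x y, TLB_rel delta (g None) (fun i => g (Some i)) x y -> x = y) ->
  forall x y, TLB_free_rel x y -> freealg_eval g x = freealg_eval g y.
Proof.
move=> gP x y /(TLB_rel_image (freealg_eval g)) fxy; apply: gP.
have gN : g None = freealg_eval g (freegen K None) by rewrite freealg_eval_gen.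
have gS : (fun i => g (Some i)) =
    freealg_eval g \o (fun i => freegen K (Some i : TLB_index)).
  by apply/funext => i; rewrite /= freealg_eval_gen.
by rewrite gN gS.
Qed.

(* s_0 |-> 1, U_i |-> 0 is a character of TL(B_n). *)
Lemma TLB_proper : ~ rel_idealP TLB_free_rel 1.
Proof.
pose chi (i : TLB_index) : K^o := if i is None then 1 else 0.
have relP x y : TLB_free_rel x y -> freealg_eval chi x = freealg_eval chi y.
  apply: TLB_free_rel_eval => _ _ [] * /=;
  by rewrite ?(mulr0, mul0r, mulr1, mul1r, scaler0).
by move=> /(rel_idealP_eval relP)/eqP; rewrite rmorph1 oner_eq0.
Qed.

Definition TLB : algType K := algquot TLB_proper.

Definition TLB_gen (i : TLB_index) : TLB := algpi TLB_proper (freegen K i).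

(* s_0 *)
Definition TLB_s0 : TLB := TLB_gen None.

(* TLB_U i is U_(i+1). *)
Definition TLB_U (i : 'I_n.-1) : TLB := TLB_gen (Some i).

Lemma TLB_relP x y : TLB_rel delta TLB_s0 TLB_U x y -> x = y.
Proof. exact: (TLB_rel_morph (algpi_rel TLB_proper)). Qed.

End Presentation.

(* The canonical morphism TL(B_n) -> TL(B_(n+1)), sending each generator to the
   generator of the same name. *)
Definition TLB_incl_gen n (i : TLB_index n) : TLB n.+1 :=
  if i is Some j then @TLB_U n.+1 (widen_ord (leq_pred n) j) else TLB_s0 n.+1.

Definition TLB_incl n : TLB n -> TLB n.+1 :=
  algquot_lift (freealg_eval (@TLB_incl_gen n)).

Section Inclusion.
Variable n : nat.

Lemma TLB_incl_rel x y : @TLB_free_rel n x y ->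
  freealg_eval (@TLB_incl_gen n) x = freealg_eval (@TLB_incl_gen n) y.
Proof.
apply: TLB_free_rel_eval => {x y} _ _ [] * /=; apply: TLB_relP.
- exact: TLB_rel_UU.
- exact: TLB_rel_UUU.
- exact: TLB_rel_UUUr.
- exact: TLB_rel_comm.
- exact: TLB_rel_ss.
- exact: TLB_rel_UsU.
- exact: TLB_rel_sU.
Qed.

Lemma TLB_incl_pi x :
  TLB_incl (algpi (@TLB_proper n) x) = freealg_eval (@TLB_incl_gen n) x.
Proof. exact: algquot_lift_pi TLB_incl_rel x. Qed.

Lemma TLB_incl_zmod : zmod_morphism (@TLB_incl n).
Proof.
elim/algquot_ind=> x; elim/algquot_ind=> y.
by rewrite -rmorphB !TLB_incl_pi rmorphB.
Qed.

Lemma TLB_incl_monoid : monoid_morphism (@TLB_incl n).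
Proof.
split; first by rewrite -(rmorph1 (algpi (@TLB_proper n))) TLB_incl_pi rmorph1.
elim/algquot_ind=> x; elim/algquot_ind=> y.
by rewrite -rmorphM !TLB_incl_pi rmorphM.
Qed.

Lemma TLB_incl_scalable : scalable (@TLB_incl n).
Proof.
by move=> c; elim/algquot_ind=> x; rewrite -linearZ !TLB_incl_pi linearZ.
Qed.

HB.instance Definition _ :=
  GRing.isZmodMorphism.Build (TLB n) (TLB n.+1) (@TLB_incl n) TLB_incl_zmod.
HB.instance Definition _ :=
  GRing.isMonoidMorphism.Build (TLB n) (TLB n.+1) (@TLB_incl n) TLB_incl_monoid.
HB.instance Definition _ :=
  GRing.isScalable.Build K (TLB n) (TLB n.+1) *:%R (@TLB_incl n)
    TLB_incl_scalable.

Lemma TLB_incl_s0 : TLB_incl (TLB_s0 n) = TLB_s0 n.+1.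
Proof. by rewrite TLB_incl_pi freealg_eval_gen. Qed.

Lemma TLB_incl_U i : TLB_incl (TLB_U i) = @TLB_U n.+1 (widen_ord (leq_pred n) i).
Proof. by rewrite TLB_incl_pi freealg_eval_gen. Qed.

End Inclusion.
End TLB.

Section Projectors.
Variable R : realType.

(* C(q), with q the indeterminate. *)
Definition Cq : fieldType := {fraction {poly R[i]}}.
Definition q : Cq := tofrac 'X.

Definition TLBq (n : nat) : algType Cq := TLB (q + q^-1) n.
Definition s0 (n : nat) : TLBq n := TLB_s0 (q + q^-1) n.

(* U i is U_(i+1). *)
Definition U (n : nat) (i : 'I_n.-1) : TLBq n := TLB_U (q + q^-1) i.

Definition TLBq_incl (n : nat) : TLBq n -> TLBq n.+1 :=
  @TLB_incl Cq (q + q^-1) n.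

(* For bn : TL(B_n) with n >= 1, the value of the recursion in TL(B_(n+1)), whose
   last generator U_n is U (ord_max : 'I_n). *)
Definition b_step (m : nat) (bn : TLBq m.+1) : TLBq m.+2 :=
  let n := m.+1 in
  let b := TLBq_incl bn in
  b - ((q ^+ n.-1 + q ^- n.-1) / (q ^+ n + q ^- n))
        *: (b * @U n.+1 (ord_max : 'I_m.+1) * b).

(* b eps n is b_(n,+) for eps = 1 and b_(n,-) for eps = -1, n >= 1; b eps 0 is a
   dummy. *)
Fixpoint b (eps : Cq) (n : nat) : TLBq n :=
  match n with
  | 0 => 0
  | m.+1 =>
    match m return TLBq m -> TLBq m.+1 with
    | 0 => fun=> 2^-1 *: (1 + eps *: s0 1)
    | _.+1 => @b_step _
    end (b eps m)
  end.

Lemma b1E eps : b eps 1 = 2^-1 *: (1 + eps *: s0 1).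
Proof. by []. Qed.

Lemma bSE eps n : b eps n.+2 = b_step (b eps n.+1).
Proof. by []. Qed.

Definition b_plus (n : nat) : TLBq n := b 1 n.
Definition b_minus (n : nat) : TLBq n := b (-1) n.

End Projectors.

(* Main.v *)
Require Import Defs.
From HB Require Import structures.
From mathcomp Require Import all_boot all_order all_algebra.
From mathcomp Require Import reals.
From mathcomp Require Import complex monalg ring.
Set Implicit Arguments.
Unset Strict Implicit.
Unset Printing Implicit Defensive.
Import GRing.Theory.
Local Open Scope ring_scope.

(* If e satisfies s_0 e = eps e = e s_0 and U_i e = 0 = e U_i, then every x in
   TL(B_n) acts on e from both sides by the same scalar, which depends only on x.
   For two such e, f this makes e f a multiple of each of them, which forces
   non-zero idempotents to be equal.  That b_n has these properties is the
   Jones-Wenzl induction, carried along with the corner identity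
   U_n b_n U_n = (d_n / d_(n-1)) p U_n, where d_n = q^n + q^-n and p = b_(n-1)
   (p = 1 for n = 1).  Finally b_n is not zero because the character s_0 |-> eps,
   U_i |-> 0 takes the value 1 on it. *)

(** * One step of the Jones-Wenzl recursion in an arbitrary algebra *)

Section JonesWenzlStep.
Variables (K : fieldType) (A : algType K).
Implicit Types (b u v p x : A) (c d k : K).

(** The recursion step with its coefficient left free; being stated in any algebra, it can be
    carried along inclusions and characters. *)
Definition jw b u c : A := b - c *: (b * u * b).

(** Both terms of [jw b u c] start with [b], so left eigenvalues of [b] are inherited. *)
Lemma mul_jw b u c x k : x * b = k *: b -> x * jw b u c = k *: jw b u c.
Proof.
move=> xb; rewrite /jw mulrBr -scalerAr !mulrA xb scalerBr.
by rewrite !scalerA -!scalerAl scalerA mulrC.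
Qed.

Lemma jw_mul b u c x k : b * x = k *: b -> jw b u c * x = k *: jw b u c.
Proof.
move=> bx; rewrite /jw mulrBl -scalerAl -!mulrA bx scalerBr.
by rewrite !scalerA -!scalerAr scalerA mulrC.
Qed.

Section Corner.
Variables (b u p : A) (c d : K).
Hypotheses (cd1 : c * d = 1) (bb : b * b = b) (pb : p * b = b) (bp : b * p = b).
Hypotheses (up : u * p = p * u) (ubu : u * b * u = d *: (p * u)).

(** The corner identity and [c * d = 1] turn [c *: (u * b * u * b)] into
    [p * u * b = u * p * b = u * b], which cancels the first term. *)
Lemma mulu_jw : u * jw b u c = 0.
Proof.
rewrite /jw mulrBr -scalerAr !mulrA ubu -scalerAl scalerA cd1 scale1r.
by rewrite -up -mulrA pb subrr.
Qed.

Lemma jw_mulu : jw b u c * u = 0.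
Proof.
rewrite /jw mulrBl -scalerAl -!mulrA [u * (b * u)]mulrA ubu -scalerAr scalerA.
by rewrite cd1 scale1r mulrA bp subrr.
Qed.

(** Write J for [jw b u c]. Since J b = J, the correction term of J J contains J u = 0, and only J b
    = J is left. *)
Lemma jw_idem : jw b u c * jw b u c = jw b u c.
Proof.
have Jb : jw b u c * b = jw b u c by rewrite (@jw_mul _ _ _ _ 1) scale1r.
by rewrite {2}/jw mulrBr -scalerAr !mulrA Jb jw_mulu mul0r scaler0 subr0.
Qed.

End Corner.

(** This propagates the corner identity: [v] is the next generator after [u], and the old [b] takes
    over the role of [p]. *)
Lemma jw_corner b u v c d : b * b = b -> v * b = b * v -> v * v = d *: v ->
  v * u * v = v -> v * jw b u c * v = (d - c) *: (b * v).
Proof.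
move=> bb vb vv vuv; rewrite /jw mulrBr mulrBl -scalerAr -scalerAl scalerBl.
congr (_ - _ *: _); first by rewrite vb -mulrA vv scalerAr.
have -> : v * (b * u * b) * v = b * (v * u * v) * b.
  by rewrite !mulrA vb -!mulrA vb.
by rewrite vuv -mulrA vb mulrA bb.
Qed.

Section InvolutionIdempotent.
Variables (s u : A) (eps h d : K).
Hypotheses (ss : s * s = 1) (eps2 : eps * eps = 1) (h2 : h * 2 = 1).

Definition invol_idem : A := h *: (1 + eps *: s).

Lemma mul_invol_idem : s * invol_idem = eps *: invol_idem.
Proof.
rewrite /invol_idem -scalerAr mulrDr mulr1 -scalerAr ss scalerA mulrC -scalerA.
by rewrite [eps *: (1 + _)]scalerDr scalerA eps2 scale1r addrC.
Qed.

Lemma invol_idem_mul : invol_idem * s = eps *: invol_idem.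
Proof.
rewrite /invol_idem -scalerAl mulrDl mul1r -scalerAl ss scalerA mulrC -scalerA.
by rewrite [eps *: (1 + _)]scalerDr scalerA eps2 scale1r addrC.
Qed.

Lemma invol_idem_idem : invol_idem * invol_idem = invol_idem.
Proof.
rewrite {1}/invol_idem -scalerAl mulrDl mul1r -scalerAl mul_invol_idem.
by rewrite scalerA eps2 scale1r -mulr2n -scaler_nat scalerA h2 scale1r.
Qed.

Lemma invol_idem_corner : u * u = d *: u -> u * s * u = 0 ->
  u * invol_idem * u = (h * d) *: u.
Proof.
move=> uu usu; rewrite /invol_idem -scalerAr -scalerAl mulrDr mulrDl mulr1.
by rewrite -scalerAr -scalerAl usu uu scaler0 addr0 scalerA.
Qed.

End InvolutionIdempotent.

End JonesWenzlStep.

(** * Transport along algebra morphisms and induction on words *)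

Section Morphisms.
Variables (K : fieldType) (A B : algType K) (f : {lrmorphism A -> B}).

Lemma rmorph_jw b u c : f (jw b u c) = jw (f b) (f u) c.
Proof. by rewrite /jw linearB linearZ !rmorphM. Qed.

Lemma rmorph_invol_idem s eps h :
  f (invol_idem s eps h) = invol_idem (f s) eps h.
Proof. by rewrite /invol_idem linearZ linearD linearZ rmorph1. Qed.

Lemma rmorph_eigenl (a x : A) (k : K) : a * x = k *: x -> f a * f x = k *: f x.
Proof. by move/(congr1 f); rewrite rmorphM linearZ. Qed.

Lemma rmorph_eigenr (a x : A) (k : K) : x * a = k *: x -> f x * f a = k *: f x.
Proof. by move/(congr1 f); rewrite rmorphM linearZ. Qed.

End Morphisms.

Lemma freealg_ind (K : fieldType) (I : choiceType) (P : freealg K I -> Prop) :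
  P 1 -> (forall c x y, P x -> P y -> P (c *: x + y)) ->
  (forall i x, P x -> P (freegen K i * x)) -> forall x, P x.
Proof.
move=> P1 PZD PM x.
have P0 : P 0 by rewrite -(addNr 1) -scaleN1r; apply: PZD.
rewrite [x]monalgE; apply: big_ind => // [y z Py Pz|m _].
  by rewrite -[y]scale1r; apply: PZD.
have -> : << x@_m *g m >> = x@_m *: (<< m >> : {malg K[{fmonom I}]}).
  by rewrite -mul_malgC malg_mulUU mulr1 mul1m.
rewrite -[_ *: _]addr0; apply: PZD => //; move: (x@_m) => _.
case: m => s; elim: s => [|i s IHs]; first by rewrite -fmoneE.
have -> : FMonom (i :: s) = mmul (fmu i) (FMonom s).
  by apply: val_inj; rewrite /= fmM fmU.
by rewrite -[1]mulr1 -malg_mulUU; apply: PM.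
Qed.

(** * Characters, commutation and absorbing elements in TL(B_n) *)

Section TLBTheory.
Variables (K : fieldType) (delta : K).

Lemma TLB_ind n (P : TLB delta n -> Prop) : P 1 ->
  (forall c x y, P x -> P y -> P (c *: x + y)) ->
  (forall i x, P x -> P (TLB_gen delta i * x)) -> forall x, P x.
Proof.
move=> P1 PZD PM; elim/algquot_ind=> x.
elim/freealg_ind: x => [|c x y Px Py|i x Px]; first by rewrite rmorph1.
  by rewrite linearP; apply: PZD.
by rewrite rmorphM; apply: PM.
Qed.

Lemma TLB_morph_ext n (B : algType K) (f g : {lrmorphism TLB delta n -> B}) :
  (forall i, f (TLB_gen delta i) = g (TLB_gen delta i)) -> f =1 g.
Proof.
move=> fg; elim/TLB_ind=> [|c x y fx fy|i x fx]; first by rewrite !rmorph1.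
  by rewrite !linearP /= fx fy.
by rewrite !rmorphM /= fg fx.
Qed.

Section Character.
Variables (eps : K) (eps2 : eps * eps = 1) (n : nat).

Definition TLB_char_gen (i : TLB_index n) : K^o := if i is None then eps else 0.

(** The proof of [eps * eps = 1] is part of the term so that the morphism instances can be inferred
    for it; it is what makes the relation s_0^2 = 1 hold. *)
Definition TLB_char of eps * eps = 1 : TLB delta n -> K^o :=
  algquot_lift (freealg_eval TLB_char_gen).

Local Notation chi := (TLB_char eps2).

Lemma TLB_char_pi x : chi (algpi _ x) = freealg_eval TLB_char_gen x.
Proof.
apply: algquot_lift_pi; apply: TLB_free_rel_eval => _ _ [] * //=;
by rewrite ?(mulr0, mul0r, scaler0).
Qed.

Lemma TLB_char_zmod : zmod_morphism chi.
Proof.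
elim/algquot_ind=> x; elim/algquot_ind=> y.
by rewrite -rmorphB !TLB_char_pi rmorphB.
Qed.

Lemma TLB_char_monoid : monoid_morphism chi.
Proof.
split.
  by rewrite -(rmorph1 (algpi (@TLB_proper _ delta n))) TLB_char_pi rmorph1.
elim/algquot_ind=> x; elim/algquot_ind=> y.
by rewrite -rmorphM !TLB_char_pi rmorphM.
Qed.

Lemma TLB_char_scalable : scalable chi.
Proof.
by move=> c; elim/algquot_ind=> x; rewrite -linearZ !TLB_char_pi linearZ.
Qed.

HB.instance Definition _ :=
  GRing.isZmodMorphism.Build (TLB delta n) K^o chi TLB_char_zmod.
HB.instance Definition _ :=
  GRing.isMonoidMorphism.Build (TLB delta n) K^o chi TLB_char_monoid.
HB.instance Definition _ :=
  GRing.isScalable.Build K (TLB delta n) K^o *:%R chi TLB_char_scalable.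

Lemma TLB_char_s0 : chi (TLB_s0 delta n) = eps.
Proof. by rewrite TLB_char_pi freealg_eval_gen. Qed.

Lemma TLB_char_U i : chi (TLB_U delta i) = 0.
Proof. by rewrite TLB_char_pi freealg_eval_gen. Qed.

End Character.

Lemma TLB_char_incl eps (eps2 : eps * eps = 1) n (x : TLB delta n) :
  TLB_char eps2 (TLB_incl x) = TLB_char eps2 x.
Proof.
apply: (@TLB_morph_ext _ _ (TLB_char eps2 \o @TLB_incl _ delta n)
  (TLB_char eps2)) => -[i|] /=.
  by rewrite [TLB_incl _]TLB_incl_U !TLB_char_U.
by rewrite [TLB_incl _]TLB_incl_s0 !TLB_char_s0.
Qed.

Lemma TLB_commute n (B : algType K) (f : {lrmorphism TLB delta n -> B})
    (u : B) :
  (forall i, u * f (TLB_gen delta i) = f (TLB_gen delta i) * u) ->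
  forall x, u * f x = f x * u.
Proof.
move=> uf; elim/TLB_ind=> [|c x y ux uy|i x ux].
- by rewrite rmorph1 mulr1 mul1r.
- by rewrite (linearP f) mulrDr mulrDl -scalerAr ux uy scalerAl.
- by rewrite (rmorphM f) mulrA uf -mulrA ux mulrA.
Qed.

(** Here [u] is U_(n+2), while [x] is built from s_0, U_1, ..., U_n, so the far commutation
    relations apply. *)
Lemma TLB_U_incl2 n (x : TLB delta n.+1) :
  let u := @TLB_U _ delta n.+3 ord_max in
  u * TLB_incl (TLB_incl x) = TLB_incl (TLB_incl x) * u.
Proof.
apply: (@TLB_commute _ _ (@TLB_incl _ delta n.+2 \o @TLB_incl _ delta n.+1)).
case=> [i|] /=.
  rewrite [TLB_incl (TLB_gen _ _)]TLB_incl_U TLB_incl_U; apply: TLB_relP.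
  by apply: TLB_rel_comm; rewrite /= !ltnS (ltn_ord i) orbT.
rewrite [TLB_incl (TLB_gen _ _)]TLB_incl_s0 TLB_incl_s0.
by apply/esym/TLB_relP; apply: TLB_rel_sU.
Qed.

(** The values 1 and -1 of [eps] give the conditions of (i) and (ii), which are thus handled
    together. *)
Definition TLB_absorbing eps n (e : TLB delta n) : Prop :=
  (TLB_s0 delta n * e = eps *: e /\ e * TLB_s0 delta n = eps *: e) /\
  (forall i, TLB_U delta i * e = 0 /\ e * TLB_U delta i = 0).

(** Induction on words: a factor s_0 multiplies the scalar by [eps], a factor U_i makes it 0.
    Choosing [k] before [e] allows comparing two absorbing elements. *)
Lemma TLB_absorbing_scalar eps n (x : TLB delta n) :
  exists k, forall e, TLB_absorbing eps e -> x * e = k *: e /\ e * x = k *: e.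
Proof.
elim/TLB_ind: x => [|c x y [k xk] [l yl]|i x [k xk]].
- by exists 1 => e _; rewrite mul1r mulr1 scale1r.
- exists (c * k + l) => e e_abs; have [xe ex] := xk e e_abs.
  have [ye ey] := yl e e_abs.
  by rewrite mulrDl mulrDr -scalerAl -scalerAr xe ex ye ey scalerDl scalerA.
case: i => [i|].
- exists 0 => e e_abs; have [xe ex] := xk e e_abs.
  have [_ /(_ i)[ue eu]] := e_abs.
  by rewrite scale0r -mulrA xe -scalerAr mulrA ue eu mul0r scaler0.
- exists (eps * k) => e e_abs; have [xe ex] := xk e e_abs.
  have [[se es] _] := e_abs.
  rewrite -mulrA xe -scalerAr mulrA se es -scalerAl ex !scalerA.
  rewrite (mulrC k eps).
  split; reflexivity.
Qed.

Lemma TLB_absorbing_idem_unique eps n (e f : TLB delta n) :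
  TLB_absorbing eps e -> TLB_absorbing eps f ->
  e * e = e -> f * f = f -> e != 0 -> f != 0 -> e = f.
Proof.
move=> e_abs f_abs ee ff e0 f0.
have scalar1 (g : TLB delta n) k : g != 0 -> g = k *: g -> k = 1.
  move=> g0 gk; have : (1 - k) *: g == 0 by rewrite scalerBl scale1r -gk subrr.
  by rewrite scaler_eq0 (negPf g0) orbF subr_eq0 => /eqP.
(* Left multiplication by [e] scales both [e] and [f] by [k]. Idempotence gives k = 1, so e f = f;
   right multiplication by [f] likewise gives e f = e. *)
have [k ek] := TLB_absorbing_scalar eps e.
have [l fl] := TLB_absorbing_scalar eps f.
have [[ee' _] [ef _]] := (ek e e_abs, ek f f_abs).
have [[_ fe] [ff' _]] := (fl e e_abs, fl f f_abs).
rewrite (scalar1 e k e0 (etrans (esym ee) ee')) scale1r in ef.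
rewrite (scalar1 f l f0 (etrans (esym ff) ff')) scale1r in fe.
exact: etrans (esym fe) ef.
Qed.

Lemma jw_absorbing eps n (x : TLB delta n.+1) c
    (u := @TLB_U _ delta n.+2 ord_max) :
  TLB_absorbing eps x ->
  u * jw (TLB_incl x) u c = 0 -> jw (TLB_incl x) u c * u = 0 ->
  TLB_absorbing eps (jw (TLB_incl x) u c).
Proof.
move=> [[sx xs] xU] uJ Ju; set y := TLB_incl x in uJ Ju *.
split=> [|i].
  rewrite -TLB_incl_s0; split; [apply: mul_jw|apply: jw_mul].
    exact: (rmorph_eigenl (@TLB_incl _ delta n.+1) sx).
  exact: (rmorph_eigenr (@TLB_incl _ delta n.+1) xs).
(* The generator is either the new last one, covered by [uJ] and [Ju], or comes from the smaller
   algebra. *)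
have [j ->|->] := unliftP ord_max i; last by [].
have -> : lift ord_max j = widen_ord (leq_pred n.+1) j.
  by apply: val_inj; rewrite /= /bump leqNgt ltn_ord.
(* Annihilation is read as eigenvalue 0. *)
have [Ux xU'] := xU j; rewrite -TLB_incl_U -(scale0r (jw y u c)).
split; [apply: mul_jw|apply: jw_mul].
  apply: (rmorph_eigenl (@TLB_incl _ delta n.+1) (etrans Ux _)).
  exact: esym (scale0r x).
apply: (rmorph_eigenr (@TLB_incl _ delta n.+1) (etrans xU' _)).
exact: esym (scale0r x).
Qed.

End TLBTheory.

(** With x = q^n and y = q this is the Chebyshev-type recursion d_1 d_(n+1) - d_n = d_(n+2). *)
Lemma addV_rec (F : fieldType) (x y : F) : x != 0 -> y != 0 ->
  (y + y^-1) * (y * x + (y * x)^-1) - (x + x^-1)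
    = y * (y * x) + (y * (y * x))^-1.
Proof. by move=> x0 y0; field; rewrite x0 y0. Qed.

(** * The elements b_n over C(q) *)

Section Projectors.
Variable R : realType.
Local Notation q := (q R).
Local Notation TL n := (TLBq R n).

Definition qplus (n : nat) : Cq R := q ^+ n + q ^- n.

Lemma q_neq0 : q != 0.
Proof. by rewrite /Defs.q tofrac_eq0 polyX_eq0. Qed.

Lemma natr_Cq_neq0 n : n.+1%:R != 0 :> Cq R.
Proof.
rewrite -(rmorph_nat (@tofrac _)) tofrac_eq0 -polyC_natr polyC_eq0.
by rewrite Num.Theory.pnatr_eq0.
Qed.

Lemma qplus_neq0 n : qplus n != 0.
Proof.
have qn0 : q ^+ n != 0 by rewrite expf_neq0 ?q_neq0.
have -> : qplus n = (q ^+ (n + n) + 1) / q ^+ n.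
  by rewrite /qplus exprD mulrDl mulfK // mul1r.
apply: mulf_neq0; last by rewrite invr_eq0.
(* For n = 0 the numerator is 2; otherwise it is the polynomial X^(2n) + 1 of positive degree. *)
case: n {qn0} => [|n]; first by rewrite expr0 -mulr2n natr_Cq_neq0.
rewrite /Defs.q -rmorphXn -(rmorph1 (@tofrac _)) -rmorphD tofrac_eq0.
by rewrite -size_poly_eq0 -(polyC1 R[i]) size_XnaddC.
Qed.

(** The left side is the coefficient produced by [jw_corner], the right side the one required at the
    next stage. *)
Lemma qplus_rec n : q + q^-1 - qplus n / qplus n.+1 = qplus n.+2 / qplus n.+1.
Proof.
apply: (mulIf (qplus_neq0 n.+1)); rewrite mulrBl !divfK ?qplus_neq0 //.
by rewrite /qplus !exprS; apply: addV_rec; rewrite ?expf_neq0 ?q_neq0.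
Qed.

Lemma b_stepE m (x : TL m.+1) :
  b_step x = jw (TLBq_incl x) (@U R m.+2 ord_max) (qplus m / qplus m.+1).
Proof. by []. Qed.

Section Sign.
Variables (eps : Cq R) (eps2 : eps * eps = 1).
Local Notation B n := (b eps n).
Local Notation delta := (q + q^-1).

Lemma b1_absorbing : TLB_absorbing eps (B 1).
Proof.
have ss : s0 R 1 * s0 R 1 = 1 by apply: TLB_relP; apply: TLB_rel_ss.
(* TL(B_1) has no U_i, as ['I_0] is empty. *)
split=> [|[]//].
by split; [apply: (mul_invol_idem _ ss eps2)|apply: (invol_idem_mul _ ss eps2)].
Qed.

Lemma mulV2 : 2^-1 * 2 = 1 :> Cq R.
Proof. exact: mulVf (natr_Cq_neq0 1). Qed.

Lemma b1_idem : B 1 * B 1 = B 1.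
Proof.
have ss : s0 R 1 * s0 R 1 = 1 by apply: TLB_relP; apply: TLB_rel_ss.
exact: (invol_idem_idem ss eps2 mulV2).
Qed.

(** U_1 s_0 U_1 = 0 leaves only half of U_1^2, and the coefficient delta / 2 is d_1 / d_0 because
    d_0 = 2. *)
Lemma b1_corner (u := @U R 2 ord_max) :
  u * TLBq_incl (B 1) * u = (qplus 1 / qplus 0) *: (1 * u).
Proof.
have uu : u * u = delta *: u by apply: TLB_relP; apply: TLB_rel_UU.
have usu : u * s0 R 2 * u = 0 by apply: TLB_relP; apply: TLB_rel_UsU.
have -> : TLBq_incl (B 1) = invol_idem (s0 R 2) eps 2^-1.
  by rewrite -[s0 R 2]TLB_incl_s0 -(rmorph_invol_idem (@TLB_incl _ delta 1)).
have -> : qplus 1 / qplus 0 = 2^-1 * delta.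
  by rewrite /qplus !expr0 expr1 invr1 mulrC.
by rewrite mul1r; apply: invol_idem_corner.
Qed.

(** The factor [p] is existential since it is 1 at the start, where [b eps 0] is a dummy, and an
    included b_m afterwards. *)
Lemma b_jones_wenzl m (x := TLBq_incl (B m.+1)) (u := @U R m.+2 ord_max) :
  [/\ TLB_absorbing eps (B m.+1), B m.+1 * B m.+1 = B m.+1
    & exists p : TL m.+2, [/\ p * x = x, x * p = x, u * p = p * u
      & u * x * u = (qplus m.+1 / qplus m) *: (p * u)]].
Proof.
elim: m @x @u => [|m IHm] x u.
  split; [exact: b1_absorbing|exact: b1_idem|exists 1].
  by rewrite !(mul1r, mulr1) -[X in _ *: X]mul1r; split=> //; apply: b1_corner.
have [x_abs xx [p [px xp up uxu]]] := IHm.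
pose y := TLBq_incl (B m.+1); pose v := @U R m.+2 ord_max.
have yy : y * y = y by rewrite /y -[LHS](rmorphM (@TLB_incl _ delta m.+1)) xx.
have cd1 : qplus m / qplus m.+1 * (qplus m.+1 / qplus m) = 1.
  by rewrite mulrA divfK ?divff ?qplus_neq0.
have BE : B m.+2 = jw y v (qplus m / qplus m.+1) by rewrite bSE b_stepE.
have BB : B m.+2 * B m.+2 = B m.+2.
  by rewrite BE; apply: (jw_idem cd1 yy xp uxu).
have B_abs : TLB_absorbing eps (B m.+2).
  rewrite BE; apply: (jw_absorbing x_abs); first exact: (mulu_jw cd1 px up uxu).
  exact: (jw_mulu cd1 xp uxu).
split; [exact: B_abs|exact: BB|].
(* For the next corner identity [p] is [f y], that is b_(m+1) included twice, so that [u] = U_(m+2)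
   commutes with it. *)
pose f := @TLB_incl _ delta m.+2.
have fyy : f y * f y = f y by rewrite -[LHS](rmorphM f) yy.
have ufy : u * f y = f y * u by apply: TLB_U_incl2.
have uu : u * u = delta *: u by apply: TLB_relP; apply: TLB_rel_UU.
have uvu : u * f v * u = u.
  rewrite [f v]TLB_incl_U; apply: TLB_relP; exact: TLB_rel_UUUr.
have xE : x = jw (f y) (f v) (qplus m / qplus m.+1).
  by rewrite /x BE [LHS](rmorph_jw f).
have fy1 : f y * f y = 1 *: f y by rewrite fyy scale1r.
exists (f y); split.
- by rewrite xE (mul_jw _ _ fy1) scale1r.
- by rewrite xE (jw_mul _ _ fy1) scale1r.
- exact: ufy.
- rewrite -qplus_rec xE; exact: (jw_corner _ fyy ufy uu uvu).
Qed.

(** The character kills the correction term at each step, so the value stays (1 + eps^2) / 2 = 1. *)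
Lemma TLB_char_b m : TLB_char eps2 (B m.+1) = 1.
Proof.
elim: m => [|m IHm].
  rewrite [LHS](rmorph_invol_idem (TLB_char eps2)).
  rewrite [X in invol_idem X]TLB_char_s0 /invol_idem.
  by rewrite -[eps *: _]/(eps * eps) eps2; apply: mulV2.
rewrite bSE b_stepE [LHS](rmorph_jw (TLB_char eps2)).
rewrite [X in jw _ X]TLB_char_U /jw.
by rewrite mulr0 mul0r scaler0 subr0 [LHS]TLB_char_incl.
Qed.

Lemma b_neq0 m : B m.+1 != 0.
Proof.
apply/eqP=> B0; have := TLB_char_b m.
by rewrite B0 (linear0 (TLB_char eps2)) => /esym/eqP; rewrite oner_eq0.
Qed.

Lemma b_unique m : unique
  (fun e : TL m.+1 => [/\ e != 0, e * e = e & TLB_absorbing eps e]) (B m.+1).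
Proof.
have [B_abs BB _] := b_jones_wenzl m.
split=> [|e [e0 ee e_abs]].
  by split; [exact: b_neq0|exact: BB|exact: B_abs].
exact: (TLB_absorbing_idem_unique B_abs e_abs BB ee (b_neq0 m) e0).
Qed.

End Sign.
End Projectors.

Theorem theorem3p3 (R : realType) (n : nat) (n_ge1 : (1 <= n)%N) :
  unique (fun e : TLBq R n =>
    [/\ e != 0, e * e = e,
        s0 R n * e = e /\ e * s0 R n = e
      & forall i : 'I_n.-1, U R i * e = 0 /\ e * U R i = 0])
    (b_plus R n)
  /\
  unique (fun e : TLBq R n =>
    [/\ e != 0, e * e = e,
        s0 R n * e = - e /\ e * s0 R n = - e
      & forall i : 'I_n.-1, U R i * e = 0 /\ e * U R i = 0])
    (b_minus R n).
Proof.
case: n n_ge1 => // n _; split.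
  have [[b0 bb [sb bU]] bP] := b_unique (mulr1 (1 : Cq R)) n.
  split=> [|e [e0 ee se eU]].
    by rewrite !scale1r in sb; split; [exact: b0|exact: bb|exact: sb|exact: bU].
  apply: bP; split; [exact: e0|exact: ee|split; last exact: eU].
  by rewrite !scale1r; exact: se.
have epsN : -1 * -1 = 1 :> Cq R by rewrite mulrNN mulr1.
have [[b0 bb [sb bU]] bP] := b_unique epsN n.
split=> [|e [e0 ee se eU]].
  by rewrite !scaleN1r in sb; split; [exact: b0|exact: bb|exact: sb|exact: bU].
apply: bP; split; [exact: e0|exact: ee|split; last exact: eU].
by rewrite !scaleN1r; exact: se.
Qed.
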